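(* Let $(\lambda_j)_{j\ge 1}$ be a sequence of strictly positive real numbers and $(\alpha_j)_{j\ge 1}$ a sequence of real numbers such that, for some $k\ge 0$, $$\sum_{j\ge 1}\frac{|\alpha_j|}{|\lambda_j|^k}<+\infty ,$$ and consider the function $$\varphi(t)=\sum_{j=1}^{+\infty}\alpha_j e^{-\lambda_j t},\qquad t\in\mathbb{R}^+ .$$ Then $\varphi$ is analytic on $\mathbb{R}^{*+}$.
   Context: Here $\mathbb{R}^+=[0,+\infty)$ and $\mathbb{R}^{*+}=(0,+\infty)$. A function is analytic on an open interval if near each point of the interval it equals the sum of a convergent power series centered at that point. *)

(* Defs.v *)
From Stdlib Require Import Reals.
From Coquelicot Require Import Coquelicot.
Open Scope R_scope.

(* The power series [sum a_n (y - x)^n] converges to [f y] for all [y] in a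
   neighbourhood of [x]. *)
Definition analytic_at (f : R -> R) (x : R) : Prop :=
  exists a : nat -> R, locally x (fun y => is_pseries a (y - x) (f y)).

Definition analytic_on_interval (f : R -> R) (a b : Rbar) : Prop :=
  forall x : R, Rbar_lt a x -> Rbar_lt x b -> analytic_at f x.

(* Sequences are indexed by [j >= 1]: the value at index [0] is unused. *)
Definition exp_term (alpha lambda : nat -> R) (t : R) (j : nat) : R :=
  alpha j * exp (- lambda j * t).

(* [Series] is total: the value is meaningful only where the series converges. *)
Definition exp_sum (alpha lambda : nat -> R) (t : R) : R :=
  Series (fun n => exp_term alpha lambda t (S n)).

(* Main.v *)
(** Expand each term around [x > 0]: [exp (- l y) = exp (- l x) * exp (- l h)]
    with [h = y - x].  For [Rabs h <= q * r] with [0 <= q < 1] and [r < x], the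
    Taylor remainder of order [n] of [exp (- l h)] is at most
    [q ^ n * exp (l * r)].  Hence the remainder of the whole sum is at most
    [q ^ n] times [sum |alpha_j| exp (- l_j (x - r))], which is finite because
    [l ^ k * exp (- l s)] is bounded in [l > 0] for each [s > 0].  This uniform
    geometric bound exchanges the two summations. *)

Require Import Defs.
From Stdlib Require Import Factorial Reals Lra Lia.
From Coquelicot Require Import Coquelicot.
Open Scope R_scope.

Lemma ex_series_le_R (a b : nat -> R) :
  (forall n, Rabs (a n) <= b n) -> ex_series b -> ex_series a.
Proof. apply (ex_series_le a b). Qed.

Lemma is_series_exp (u : R) :
  is_series (fun n => u ^ n / INR (fact n)) (exp u).
Proof.
  apply is_series_ext with (fun n => / INR (fact n) * u ^ n).
  - intros n; unfold Rdiv; apply Rmult_comm.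
  - apply is_pseries_R, is_exp_Reals.
Qed.

(** All terms are nonnegative, so a single one is at most a partial sum, hence at most the full
    sum. *)
Lemma exp_taylor_term_le (v : R) (n : nat) :
  0 <= v -> v ^ n / INR (fact n) <= exp v.
Proof.
  intros Hv.
  assert (Hpos : forall i, 0 <= v ^ i / INR (fact i)).
  { intros i; apply Rmult_le_pos.
    - now apply pow_le.
    - left; apply Rinv_0_lt_compat, INR_fact_lt_0. }
  apply Rle_trans with (sum_f_R0 (fun i => v ^ i / INR (fact i)) n).
  - destruct n as [|n]; [apply Rle_refl|].
    rewrite tech5.
    generalize (cond_pos_sum (fun i => v ^ i / INR (fact i)) n Hpos); lra.
  - apply sum_incr; [|exact Hpos].
    apply is_series_Reals, is_series_exp.
Qed.

(** For [m >= S n], [q <= 1] gives [|u|^m <= (q v)^m <= q^(S n) v^m]. Summing over the tail leaves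
    [q^(S n)] times the tail of [exp v], itself at most [exp v]. *)
Lemma exp_taylor_remainder_le (u v q : R) (n : nat) :
  0 <= q <= 1 -> 0 <= v -> Rabs u <= q * v ->
  Rabs (exp u - sum_n (fun i => u ^ i / INR (fact i)) n) <= q ^ S n * exp v.
Proof.
  intros Hq Hv Hu.
  assert (Hfact : forall i, 0 < / INR (fact i)).
  { intros i; apply Rinv_0_lt_compat, INR_fact_lt_0. }
  assert (Hpos : forall i, 0 <= v ^ i / INR (fact i)).
  { intros i; apply Rmult_le_pos; [now apply pow_le|now apply Rlt_le]. }
  pose (tail w i := w ^ (S n + i) / INR (fact (S n + i))).
  assert (Hex : forall w, ex_series (tail w)).
  { intros w; apply (ex_series_incr_n (fun i => w ^ i / INR (fact i)) (S n)).
    exists (exp w); apply is_series_exp. }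
  assert (Hsplit : forall w,
    exp w = sum_n (fun i => w ^ i / INR (fact i)) n + Series (tail w)).
  { intros w; rewrite <- (is_series_unique _ _ (is_series_exp w)).
    rewrite (Series_incr_n _ (S n)); [|lia|now exists (exp w); apply is_series_exp].
    now simpl pred; rewrite <- sum_n_Reals. }
  assert (Hterm : forall i, Rabs (tail u i) <= q ^ S n * tail v i).
  { intros i; unfold tail, Rdiv.
    rewrite Rabs_mult, (Rabs_pos_eq (/ _)), <- Rmult_assoc by now apply Rlt_le.
    apply Rmult_le_compat_r; [now apply Rlt_le|].
    rewrite <- RPow_abs.
    apply Rle_trans with ((q * v) ^ (S n + i)).
    - apply pow_incr; split; [apply Rabs_pos|exact Hu].
    - rewrite Rpow_mult_distr.
      apply Rmult_le_compat_r; [now apply pow_le|].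
      rewrite pow_add, <- Rmult_1_r.
      apply Rmult_le_compat_l; [apply pow_le; lra|].
      rewrite <- (pow1 i); apply pow_incr; lra. }
  assert (Hexq : ex_series (fun i => q ^ S n * tail v i)).
  { apply (ex_series_scal_l (q ^ S n) (tail v)), Hex. }
  assert (Hexa : ex_series (fun i => Rabs (tail u i))).
  { apply ex_series_le_R with (2 := Hexq).
    intros i; now rewrite Rabs_Rabsolu. }
  replace (exp u - _) with (Series (tail u)) by (rewrite (Hsplit u); ring).
  apply Rle_trans with (1 := Series_Rabs _ Hexa).
  apply Rle_trans with (Series (fun i => q ^ S n * tail v i)).
  - apply Series_le; [|exact Hexq].
    intros i; split; [apply Rabs_pos|apply Hterm].
  - rewrite Series_scal_l.
    apply Rmult_le_compat_l; [apply pow_le; lra|].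
    rewrite (Hsplit v), sum_n_Reals.
    generalize (cond_pos_sum (fun i => v ^ i / INR (fact i)) n Hpos); lra.
Qed.

(** Put [y = l s / (k + 1)], so that [l = y (k + 1) / s]. Then [k ln y <= k y <= (k + 1) y = l s],
    and taking logarithms finishes. The maximum is at [l = k / s]; using [k + 1] instead keeps the
    logarithm meaningful when [k = 0]. *)
Lemma Rpower_mul_exp_le (k s l : R) :
  0 <= k -> 0 < s -> 0 < l ->
  Rpower l k * exp (- l * s) <= exp (k * ln ((k + 1) / s)).
Proof.
  intros Hk Hs Hl.
  unfold Rpower; rewrite <- exp_plus.
  apply Rnot_lt_le; intros Hlt; apply exp_lt_inv in Hlt.
  revert Hlt; apply Rle_not_lt.
  assert (Hy : 0 < l * s / (k + 1)).
  { apply Rdiv_lt_0_compat; [now apply Rmult_lt_0_compat|lra]. }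
  assert (Hz : 0 < (k + 1) / s) by (apply Rdiv_lt_0_compat; lra).
  replace l with (l * s / (k + 1) * ((k + 1) / s)) at 1 by (field; lra).
  rewrite ln_mult by assumption.
  (* From [y < 1 + y < exp y]. *)
  assert (Hln : ln (l * s / (k + 1)) <= l * s / (k + 1)).
  { apply Rlt_le, exp_lt_inv; rewrite exp_ln by assumption.
    generalize (exp_ineq1 _ (Rgt_not_eq _ _ Hy)); lra. }
  assert (Hle : k * (l * s / (k + 1)) <= l * s).
  { replace (l * s) with ((k + 1) * (l * s / (k + 1))) at 2 by (field; lra).
    apply Rmult_le_compat_r; lra. }
  generalize (Rmult_le_compat_l _ _ _ Hk Hln); lra.
Qed.

(** Only this finite exchange of sums is done directly; the infinite one comes from letting the
    remainder tend to 0. *)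
Lemma is_series_sum_n (a : nat -> nat -> R) (c : nat -> R) (n : nat) :
  (forall i, is_series (a i) (c i)) ->
  is_series (fun j => sum_n (fun i => a i j) n) (sum_n c n).
Proof.
  intros Ha; induction n as [|n IHn].
  - rewrite sum_O; apply is_series_ext with (2 := Ha 0%nat).
    intros j; now rewrite sum_O.
  - rewrite sum_Sn.
    apply is_series_ext with (2 := is_series_plus _ _ _ _ IHn (Ha (S n))).
    intros j; now rewrite sum_Sn.
Qed.

Section ExpSeries.

Variables a l : nat -> R.
Hypothesis l_pos : forall j, 0 < l j.
Hypothesis a_summable :
  forall s, 0 < s -> ex_series (fun j => Rabs (a j) * exp (- l j * s)).

Lemma ex_series_exp_term (s : R) :
  0 < s -> ex_series (fun j => a j * exp (- l j * s)).
Proof.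
  intros Hs; apply ex_series_Rabs.
  apply ex_series_ext with (2 := a_summable s Hs).
  intros j; rewrite Rabs_mult, (Rabs_pos_eq (exp _)); [easy|apply Rlt_le, exp_pos].
Qed.

(** With [r = x / 2], one Taylor term of [exp (l r)] gives [l^n / n! <= r^(-n) exp (l r)]. Half of
    the decay of [exp (- l x)] absorbs this growth, and the other half, [exp (- l r)], makes the
    series converge by [a_summable]. *)
Lemma ex_series_taylor_coef (x : R) (n : nat) :
  0 < x ->
  ex_series (fun j => a j * exp (- l j * x) * ((- l j) ^ n / INR (fact n))).
Proof.
  intros Hx.
  assert (Hr : 0 < x / 2) by lra.
  apply (ex_series_le_R _
    (fun j => / (x / 2) ^ n * (Rabs (a j) * exp (- l j * (x / 2))))).
  2: now apply (ex_series_scal_l (/ (x / 2) ^ n)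
       (fun j => Rabs (a j) * exp (- l j * (x / 2)))), a_summable.
  intros j.
  assert (Hlr : 0 <= l j * (x / 2)) by (apply Rmult_le_pos; [apply Rlt_le, l_pos|lra]).
  generalize (exp_taylor_term_le _ n Hlr); intros Hterm.
  replace (exp (- l j * (x / 2))) with (exp (- l j * x) * exp (l j * (x / 2)))
    by (rewrite <- exp_plus; f_equal; field).
  unfold Rdiv at 1.
  rewrite !Rabs_mult, <- RPow_abs, Rabs_Ropp.
  rewrite (Rabs_pos_eq (exp _)) by apply Rlt_le, exp_pos.
  rewrite (Rabs_pos_eq (l j)) by apply Rlt_le, l_pos.
  rewrite (Rabs_pos_eq (/ _)) by apply Rlt_le, Rinv_0_lt_compat, INR_fact_lt_0.
  replace (l j ^ n * / INR (fact n))
    with (/ (x / 2) ^ n * ((l j * (x / 2)) ^ n / INR (fact n))).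
  2: { rewrite Rpow_mult_distr; field; split; [apply INR_fact_neq_0|].
       apply pow_nonzero; lra. }
  assert (Hc : 0 <= Rabs (a j) * exp (- l j * x) * / (x / 2) ^ n).
  { repeat apply Rmult_le_pos.
    - apply Rabs_pos.
    - apply Rlt_le, exp_pos.
    - apply Rlt_le, Rinv_0_lt_compat, pow_lt, Hr. }
  generalize (Rmult_le_compat_l _ _ _ Hc Hterm); lra.
Qed.

(** Apply [exp_taylor_remainder_le] to each term with [u = - l_j h] and [v = l_j x / 2]. The factor
    [exp (- l_j x) exp (l_j x / 2)] is [exp (- l_j x / 2)], which is summable against [|a_j|]. *)
Lemma exp_series_taylor_remainder_le (x h q : R) (n : nat) :
  0 < x -> 0 <= q <= 1 -> Rabs h <= q * (x / 2) ->
  Rabs (Series (fun j => a j * exp (- l j * (x + h)))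
        - sum_n (fun i =>
            Series (fun j => a j * exp (- l j * x) * ((- l j) ^ i / INR (fact i)))
            * h ^ i) n)
  <= q ^ S n * Series (fun j => Rabs (a j) * exp (- l j * (x / 2))).
Proof.
  intros Hx Hq Hh.
  assert (Hr : 0 < x / 2) by lra.
  assert (Hxh : 0 < x + h).
  { assert (Rabs h <= x / 2) by nra.
    generalize (Rabs_maj2 h); lra. }
  (* [P j] is the Taylor polynomial of degree [n] in [h] of the [j]-th term. *)
  pose (P j := sum_n (fun i =>
    a j * exp (- l j * x) * ((- l j) ^ i / INR (fact i)) * h ^ i) n).
  assert (HP : is_series P (sum_n (fun i =>
    Series (fun j => a j * exp (- l j * x) * ((- l j) ^ i / INR (fact i)))
    * h ^ i) n)).
  { apply (is_series_sum_n (fun i j =>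
      a j * exp (- l j * x) * ((- l j) ^ i / INR (fact i)) * h ^ i)).
    intros i; apply is_series_scal_r, Series_correct, ex_series_taylor_coef, Hx. }
  assert (HPj : forall j, P j = a j * exp (- l j * x)
    * sum_n (fun i => (- l j * h) ^ i / INR (fact i)) n).
  { intros j; unfold P.
    rewrite <- (sum_n_mult_l (K := R_Ring) (a j * exp (- l j * x))).
    apply sum_n_ext; intros i; unfold mult; simpl mult.
    rewrite Rpow_mult_distr; unfold Rdiv; simpl; ring. }
  assert (Hterm : forall j, Rabs (a j * exp (- l j * (x + h)) - P j)
    <= q ^ S n * (Rabs (a j) * exp (- l j * (x / 2)))).
  { intros j; rewrite HPj, Rmult_plus_distr_l, exp_plus.
    replace (a j * (exp (- l j * x) * exp (- l j * h)) - _)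
      with (a j * exp (- l j * x) * (exp (- l j * h)
        - sum_n (fun i => (- l j * h) ^ i / INR (fact i)) n)) by ring.
    rewrite !Rabs_mult, (Rabs_pos_eq (exp _)) by apply Rlt_le, exp_pos.
    replace (exp (- l j * (x / 2))) with (exp (- l j * x) * exp (l j * (x / 2)))
      by (rewrite <- exp_plus; f_equal; field).
    generalize (l_pos j); intros Hl.
    assert (Hlr : 0 <= l j * (x / 2)) by (apply Rmult_le_pos; lra).
    assert (Hlh : Rabs (- l j * h) <= q * (l j * (x / 2))).
    { rewrite Rabs_mult, Rabs_Ropp, (Rabs_pos_eq (l j)) by lra.
      generalize (Rmult_le_compat_l _ _ _ (Rlt_le _ _ Hl) Hh); lra. }
    assert (Hc : 0 <= Rabs (a j) * exp (- l j * x)).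
    { apply Rmult_le_pos; [apply Rabs_pos|apply Rlt_le, exp_pos]. }
    generalize (Rmult_le_compat_l _ _ _ Hc
      (exp_taylor_remainder_le _ _ _ n Hq Hlr Hlh)); lra. }
  assert (Hexq : ex_series (fun j => q ^ S n * (Rabs (a j) * exp (- l j * (x / 2))))).
  { now apply (ex_series_scal_l (q ^ S n)
      (fun j => Rabs (a j) * exp (- l j * (x / 2)))), a_summable. }
  (* Merging the two series requires both to converge; at [x + h] this uses [Hxh]. *)
  rewrite <- (is_series_unique _ _ HP), <- Series_minus, <- Series_scal_l;
    [|now apply ex_series_exp_term|eexists; exact HP].
  assert (Hexa : ex_series (fun j => Rabs (a j * exp (- l j * (x + h)) - P j))).
  { apply ex_series_le_R with (2 := Hexq).
    intros j; now rewrite Rabs_Rabsolu. }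
  apply Rle_trans with (1 := Series_Rabs _ Hexa).
  apply Series_le; [|exact Hexq].
  intros j; split; [apply Rabs_pos|apply Hterm].
Qed.

Lemma analytic_at_exp_series (x : R) :
  0 < x -> analytic_at (fun t => Series (fun j => a j * exp (- l j * t))) x.
Proof.
  intros Hx.
  exists (fun i =>
    Series (fun j => a j * exp (- l j * x) * ((- l j) ^ i / INR (fact i)))).
  assert (Hr : 0 < x / 2) by lra.
  exists (mkposreal _ Hr); intros y Hy.
  change (Rabs (y - x) < x / 2) in Hy.
  apply is_pseries_R.
  (* This [q] turns the hypothesis on [h = y - x] into an equality, and [q < 1] holds strictly
     inside the ball. It does not depend on [n], so [q ^ S n * M] tends to 0 and the partial sums
     are squeezed. *)
  pose (q := Rabs (y - x) / (x / 2)).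
  pose (M := Series (fun j => Rabs (a j) * exp (- l j * (x / 2)))).
  assert (Hqr : Rabs (y - x) = q * (x / 2)) by (unfold q; field; lra).
  assert (Hq0 : 0 <= q).
  { apply Rmult_le_pos; [apply Rabs_pos|now apply Rlt_le, Rinv_0_lt_compat]. }
  assert (Hq1 : q < 1) by nra.
  change (is_lim_seq (sum_n (fun i =>
    Series (fun j => a j * exp (- l j * x) * ((- l j) ^ i / INR (fact i)))
    * (y - x) ^ i)) (Series (fun j => a j * exp (- l j * y)))).
  assert (Hgeom : is_lim_seq (fun n => q ^ S n * M) 0).
  { replace (Finite 0) with (Finite (0 * M)) by now rewrite Rmult_0_l.
    apply is_lim_seq_mult'; [|apply is_lim_seq_const].
    apply (is_lim_seq_incr_1 (fun n => q ^ n)), is_lim_seq_geom.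
    now rewrite Rabs_pos_eq. }
  set (F := Series (fun j => a j * exp (- l j * y))).
  apply is_lim_seq_le_le with
    (u := fun n => F - q ^ S n * M) (w := fun n => F + q ^ S n * M).
  - intros n.
    assert (Hrem := exp_series_taylor_remainder_le x (y - x) q n Hx
      (conj Hq0 (Rlt_le _ _ Hq1)) (Req_le _ _ Hqr)).
    rewrite (Rplus_minus x y) in Hrem.
    fold F M in Hrem; apply Rabs_le_between in Hrem; lra.
  - replace (Finite F) with (Finite (F - 0)) by now rewrite Rminus_0_r.
    apply is_lim_seq_minus'; [apply is_lim_seq_const|exact Hgeom].
  - replace (Finite F) with (Finite (F + 0)) by now rewrite Rplus_0_r.
    apply is_lim_seq_plus'; [apply is_lim_seq_const|exact Hgeom].
Qed.

End ExpSeries.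

(** Factor the term as [(|a_j| / l_j^k) (l_j^k exp (- l_j s))]; the second factor is at most [C],
    uniformly in [j]. This supplies [a_summable]. *)
Lemma ex_series_Rabs_mul_exp (a l : nat -> R) (k s : R) :
  (forall j, 0 < l j) -> 0 <= k ->
  ex_series (fun j => Rabs (a j) / Rpower (Rabs (l j)) k) ->
  0 < s -> ex_series (fun j => Rabs (a j) * exp (- l j * s)).
Proof.
  intros Hl Hk Ha Hs.
  pose (C := exp (k * ln ((k + 1) / s))).
  apply (ex_series_le_R _ (fun j => C * (Rabs (a j) / Rpower (Rabs (l j)) k))).
  2: now apply (ex_series_scal_l C (fun j => Rabs (a j) / Rpower (Rabs (l j)) k)).
  intros j; rewrite Rabs_mult, Rabs_Rabsolu, (Rabs_pos_eq (exp _)) by apply Rlt_le, exp_pos.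
  rewrite (Rabs_pos_eq (l j)) by apply Rlt_le, Hl.
  assert (HR : 0 < Rpower (l j) k) by apply exp_pos.
  assert (Hc : 0 <= Rabs (a j) / Rpower (l j) k).
  { apply Rmult_le_pos; [apply Rabs_pos|now apply Rlt_le, Rinv_0_lt_compat]. }
  replace (Rabs (a j) * exp (- l j * s))
    with (Rabs (a j) / Rpower (l j) k * (Rpower (l j) k * exp (- l j * s)))
    by (field; lra).
  rewrite (Rmult_comm C).
  apply Rmult_le_compat_l; [exact Hc|].
  now apply Rpower_mul_exp_le.
Qed.

Theorem corollary1 (lambda alpha : nat -> R) (k : R)
  (hlambda : forall j : nat, (1 <= j)%nat -> 0 < lambda j)
  (hk : 0 <= k)
  (hsum : ex_series (fun n => Rabs (alpha (S n)) / Rpower (Rabs (lambda (S n))) k)) :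
  (forall t : R, 0 < t -> ex_series (fun n => exp_term alpha lambda t (S n))) /\
  analytic_on_interval (exp_sum alpha lambda) (Finite 0) p_infty.
Proof.
  (* The general results index from 0, so they are applied to the sequences shifted by one. *)
  assert (Hl : forall j, 0 < lambda (S j)) by (intros j; apply hlambda; lia).
  assert (Ha : forall s, 0 < s ->
    ex_series (fun j => Rabs (alpha (S j)) * exp (- lambda (S j) * s))).
  { intros s; exact (ex_series_Rabs_mul_exp (fun j => alpha (S j))
      (fun j => lambda (S j)) k s Hl hk hsum). }
  (* The convergence claim ensures that [exp_sum] is a genuine sum for [t > 0], not a default value
     of [Series]. *)
  split.
  - exact (ex_series_exp_term (fun j => alpha (S j)) (fun j => lambda (S j)) Ha).
  - intros x Hx _.
    exact (analytic_at_exp_series (fun j => alpha (S j)) (fun j => lambda (S j))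
      Hl Ha x Hx).
Qed.
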